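(* Given $n,m,\sigma_x,\sigma_y,C_x,C_y,T$ with $1\le m\le n$, the DPFMix mechanism satisfies $(\alpha,\epsilon_{RDP}(\alpha))$-Rényi DP for every integer $\alpha\ge2$, where, with $p=m/n$, $$\epsilon_{RDP}(\alpha)=\frac{T}{\alpha-1}\log\Big\{(1-p)^{\alpha-1}(\alpha p-p+1)+\sum_{\ell=2}^{\alpha}\binom{\alpha}{\ell}(1-p)^{\alpha-\ell}p^{\ell}\,e^{(\ell-1)\left(\frac{\alpha}{2\sigma_x^2}+\frac{\alpha}{2\sigma_y^2}\right)}\Big\}.$$
   Context: DPFMix mechanism: input is a dataset $S=\{(x_1,y_1),\dots,(x_n,y_n)\}$, a fixed feature map $f_1$, mixup degree $m$, noise multipliers $\sigma_x,\sigma_y$, clipping bounds $C_x,C_y$, output size $T$. For each $t=1,\dots,T$ independently: include each index $i$ independently with probability $m/n$ giving $I_t$; for $i\in I_t$ set $x_i^{(t)}=f_1(x_i)/\max(1,\|f_1(x_i)\|_2/C_x)$, $y_i^{(t)}=y_i/\max(1,\|y_i\|_2/C_y)$; release $\bar x_t=\frac1m\sum_{i\in I_t}x_i^{(t)}+\mathcal N(0,(C_x\sigma_x/m)^2I)$ and $\bar y_t=\frac1m\sum_{i\in I_t}y_i^{(t)}+\mathcal N(0,(C_y\sigma_y/m)^2I)$ with fresh independent noise. Neighboring datasets differ by adding or removing one record. A mechanism $M$ is $(\alpha,\epsilon)$-Rényi DP if $D_\alpha(M(S)\|M(S'))\le\epsilon$ for all neighboring $S,S'$, where $D_\alpha(P\|Q)=\frac1{\alpha-1}\log\mathbb{E}_Q[(dP/dQ)^\alpha]$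 is the Rényi divergence of order $\alpha$. *)

(* Defs.v *)
From HB Require Import structures.
From mathcomp Require Import all_boot all_order all_algebra.
From mathcomp Require Import all_classical all_reals all_analysis.
Set Implicit Arguments. Unset Strict Implicit. Unset Printing Implicit Defensive.
Import Order.TTheory GRing.Theory Num.Theory.
Import numFieldNormedType.Exports.
Local Open Scope ring_scope.

Section DPFMix.
Variable R : realType.

Definition sqnorm2 (d : nat) (v : 'rV[R]_d) : R := \sum_(i < d) (v ord0 i) ^+ 2.
Definition norm2 (d : nat) (v : 'rV[R]_d) : R := Num.sqrt (sqnorm2 v).

Definition clip (d : nat) (C : R) (v : 'rV[R]_d) : 'rV[R]_d :=
  (Num.max 1 (norm2 v / C))^-1 *: v.

Definition gauss_pdf (d : nat) (s : R) (v : 'rV[R]_d) : R :=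
  (Num.sqrt (2 * pi * s ^+ 2)) ^- d * expR (- sqnorm2 v / (2 * s ^+ 2)).

Definition vcons (d : nat) (x : R) (v : 'rV[R]_d) : 'rV[R]_d.+1 :=
  \row_(i < d.+1) match unlift ord0 i with Some j => v ord0 j | None => x end.

(* Lebesgue integral of a (nonnegative) function over R^d, as the iterated
   integral of the one-dimensional Lebesgue integral (Tonelli). *)
Fixpoint int_rV (d : nat) : ('rV[R]_d -> \bar R) -> \bar R :=
  match d return ('rV[R]_d -> \bar R) -> \bar R with
  | 0 => fun f => f 0
  | d'.+1 => fun f =>
      (\int[@lebesgue_measure R]_x int_rV (fun v => f (vcons x v)))%E
  end.

(* Lebesgue integral over the output space ((R^dx) x (R^dy))^T of DPFMix;
   an output is a length-T sequence of pairs (xbar_t, ybar_t). *)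
Fixpoint int_out (dx dy T : nat)
    (f : seq ('rV[R]_dx * 'rV[R]_dy) -> \bar R) : \bar R :=
  match T with
  | 0 => f [::]
  | T'.+1 => @int_rV dx (fun a => @int_rV dy (fun b =>
               @int_out dx dy T' (fun s => f ((a, b) :: s))))
  end.

(* Renyi divergence of order alpha between two distributions on an output
   space with densities P, Q (w.r.t. the reference measure whose integral is
   intg), Q everywhere positive, so dP/dQ = P/Q:
   D_alpha(P||Q) = 1/(alpha-1) log E_Q[(dP/dQ)^alpha]   (+oo if infinite). *)
Definition renyi_div (O : Type) (intg : (O -> \bar R) -> \bar R)
    (alpha : R) (P Q : O -> R) : \bar R :=
  match intg (fun o => (((P o / Q o) `^ alpha) * Q o)%:E) with
  | EFin r => (ln r / (alpha - 1))%:E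
  | _ => +oo%E
  end.

Definition neighbors (A : Type) (S S' : seq A) : Prop :=
  exists s1 r s2, (S = s1 ++ r :: s2 /\ S' = s1 ++ s2) \/
                  (S' = s1 ++ r :: s2 /\ S = s1 ++ s2).

Section Mech.
Variables (X : Type) (dx dy : nat) (f1 : X -> 'rV[R]_dx).
Variables (n m : nat) (sx sy Cx Cy : R).

(* density of one round (xbar_t, ybar_t) of DPFMix on dataset S:
   mixture over the Poisson-sampled index set I (encoded as a bit mask b,
   each index included independently with probability m/n) of the Gaussians
   centred at the averaged clipped features/labels. *)
Definition dpfmix_round_pdf (S : seq (X * 'rV[R]_dy))
    (o : 'rV[R]_dx * 'rV[R]_dy) : R :=
  let p := m%:R / n%:R in
  \sum_(b : (size S).-tuple bool)
     p ^+ (count id b) * (1 - p) ^+ (size S - count id b) *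
     gauss_pdf (Cx * sx / m%:R)
       (o.1 - m%:R^-1 *: \sum_(r <- mask b S) clip Cx (f1 r.1)) *
     gauss_pdf (Cy * sy / m%:R)
       (o.2 - m%:R^-1 *: \sum_(r <- mask b S) clip Cy r.2).

Definition dpfmix_pdf (S : seq (X * 'rV[R]_dy))
    (out : seq ('rV[R]_dx * 'rV[R]_dy)) : R :=
  \prod_(o <- out) dpfmix_round_pdf S o.

End Mech.

Definition eps_rdp (n m : nat) (sx sy : R) (T alpha : nat) : R :=
  let p := m%:R / n%:R in
  let a := alpha%:R : R in
  T%:R / (a - 1) *
  ln ((1 - p) ^+ (alpha - 1) * (a * p - p + 1) +
      \sum_(2 <= l < alpha.+1)
         'C(alpha, l)%:R * (1 - p) ^+ (alpha - l) * p ^+ l *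
         expR ((l%:R - 1) * (a / (2 * sx ^+ 2) + a / (2 * sy ^+ 2)))).

End DPFMix.

(* Main.v *)
Require Import Defs.
From HB Require Import structures.
From mathcomp Require Import all_boot all_order all_algebra.
From mathcomp Require Import all_classical all_reals all_analysis.
From mathcomp Require Import ring lra.
Import Order.TTheory GRing.Theory Num.Theory.
Local Open Scope ring_scope.

(** Let B and B' be the densities of one round without and with the extra
    record, for a fixed sample of the other records: Gaussians whose squared
    normalised distance D is at most 1/sx^2 + 1/sy^2. With r = B'/B and
    u = 1 - p + p r, a round has densities that are the same convex combination
    of the B and of the u B, so by joint convexity of (P, Q) |-> P^a Q^(1-a) it
    is enough to bound the integrals of B u^a (record added) and of B u^(1-a)
    (record removed). The first is a binomial sum of the moments
    E_k = int B r^k = exp(k (k - 1) D / 2).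

    For the second, u^a - u^(1-a) = (u - 1) Psi((u - 1)^2 / u) for a polynomial
    Psi with nonnegative coefficients. Replacing u by r in the denominator
    moves the argument of Psi in the direction that makes the right-hand side
    smaller, whence
      u^(1-a) <= u^a - p (r - 1) Psi(p^2 (r - 1)^2 / r).
    The correction is a Laurent polynomial in r, a combination of the
    (r - 1)^(2j+1) / r^j, and these integrate to 0 against B because
    E_k = E_(1-k). So both directions have the same bound. *)

Set Implicit Arguments.
Unset Strict Implicit.

(** * Iterated integrals over R^d and over sequences of rounds *)

Section IntegralPredicates.
Context {R : realType}.

(* An integral predicate [K F I] reads: F is (iteratedly) integrable, with
   integral I.  Tracking integrability along with the value lets signed
   combinations of Gaussians be integrated without any Fubini argument. *)
Definition linear_pred (A : Type) (K : (A -> R) -> R -> Prop) :=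
  forall c F I G J, K F I -> K G J ->
  K (fun x => c * F x + G x) (c * I + J).

(** The inner integral must exist for every value of the outer variable, not just almost every one,
    so iterated integrals can be rewritten pointwise. *)
Definition iter_pred (A B : Type) (K : (A -> R) -> R -> Prop)
    (L : (B -> R) -> R -> Prop) (F : A -> B -> R) (I : R) :=
  exists J, (forall a, L (F a) (J a)) /\ K J I.

Definition line_integral (F : R -> R) (I : R) :=
  lebesgue_measure.-integrable setT (EFin \o F) /\
  (\int[@lebesgue_measure R]_x (F x)%:E = I%:E)%E.

Fixpoint rV_integral (d : nat) : ('rV[R]_d -> R) -> R -> Prop :=
  match d return ('rV[R]_d -> R) -> R -> Prop with
  | 0 => fun F I => F 0 = I
  | d'.+1 => fun F => iter_pred line_integral (@rV_integral d')
                        (fun x v => F (vcons x v))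
  end.

Definition round_integral (dx dy : nat) (F : 'rV[R]_dx * 'rV[R]_dy -> R) :=
  iter_pred (@rV_integral dx) (@rV_integral dy) (fun a b => F (a, b)).

Lemma linear_iter_pred {A B : Type} {K : (A -> R) -> R -> Prop}
    {L : (B -> R) -> R -> Prop} (c : R) (F : A -> B -> R) (I : R)
    (G : A -> B -> R) (J : R) :
  linear_pred K -> linear_pred L -> iter_pred K L F I -> iter_pred K L G J ->
  iter_pred K L (fun a b => c * F a b + G a b) (c * I + J).
Proof.
move=> lK lL [F1 [FF1 KF1]] [G1 [GG1 KG1]].
by exists (fun a => c * F1 a + G1 a); split=> [a|]; [exact: lL|exact: lK].
Qed.

Lemma linear_line_integral : linear_pred line_integral.
Proof.
move=> c F I G J [iF FI] [iG GJ].
have icF : lebesgue_measure.-integrable setT (fun x => (c%:E * (F x)%:E)%E).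
  exact: integrableZl.
split.
  rewrite (_ : EFin \o _ = (fun x => c%:E * (F x)%:E)%E \+ (EFin \o G))%E.
    exact: integrableD.
  by apply: funext => x /=; rewrite EFinD EFinM.
under eq_integral do rewrite EFinD EFinM.
by rewrite integralD// integralZl// FI GJ EFinD EFinM.
Qed.

Lemma linear_rV_integral (d : nat) : linear_pred (@rV_integral d).
Proof.
elim: d => [|d IHd] c F I G J /=; first by move=> <- <-.
by move=> FI GJ; apply: linear_iter_pred => //; exact: linear_line_integral.
Qed.

Lemma linear_round_integral (dx dy : nat) :
  linear_pred (@round_integral dx dy).
Proof.
by move=> c F I G J FI GJ; apply: linear_iter_pred => //;
  exact: linear_rV_integral.
Qed.

Lemma rV_integral0 (d : nat) : rV_integral (fun=> 0 : R) (0 : R) (d := d).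
Proof.
elim: d => //= d IHd; exists (fun=> 0); split => //; split.
  exact: integrable0.
by rewrite integral0.
Qed.

Lemma rV_integralZ (d : nat) (c : R) (F : 'rV[R]_d -> R) (I : R) :
  rV_integral F I -> rV_integral (fun v => c * F v) (c * I).
Proof.
move=> FI; have := linear_rV_integral c FI (rV_integral0 d).
by rewrite addr0; under eq_fun do rewrite addr0.
Qed.

Lemma round_integral0 (dx dy : nat) :
  round_integral (fun=> 0 : R) (0 : R) (dx := dx) (dy := dy).
Proof. by exists (fun=> 0); split=> *; exact: rV_integral0. Qed.

Lemma round_integralZ (dx dy : nat) (c : R) (F : 'rV[R]_dx * 'rV[R]_dy -> R)
    (I : R) : round_integral F I ->
  round_integral (fun o => c * F o) (c * I).
Proof.
move=> FI.
have := @linear_round_integral dx dy c _ _ _ _ FI (round_integral0 dx dy).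
by rewrite addr0; under eq_fun do rewrite addr0.
Qed.

Lemma round_integral_sum (dx dy : nat) (K : Type) (s : seq K) (P : pred K)
    (c : K -> R) (F : K -> 'rV[R]_dx * 'rV[R]_dy -> R) (I : K -> R) :
  (forall k, P k -> round_integral (F k) (I k)) ->
  round_integral (fun o => \sum_(k <- s | P k) c k * F k o)
                 (\sum_(k <- s | P k) c k * I k).
Proof.
move=> FI; elim: s => [|k s IHs].
  by under eq_fun do rewrite big_nil; rewrite big_nil; exact: round_integral0.
under eq_fun do rewrite big_cons; rewrite big_cons; case: ifP => // Pk.
by apply: linear_round_integral => //; exact: FI.
Qed.

Lemma eq_rV_integral (d : nat) (F : 'rV[R]_d -> R) (I : R) :
  rV_integral F I -> int_rV (fun v => (F v)%:E) = I%:E.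
Proof.
elim: d F I => [|d IHd] F I /=; first by move=> <-.
move=> [J [FJ [_ <-]]]; apply: eq_integral => x _; exact: IHd.
Qed.

(* The library's [ge0_le_integral] asks for measurability; for nonnegative
   functions the integral is a supremum over simple functions below. *)
Lemma ge0_le_integralT (f g : R -> \bar R) :
  (forall x, 0 <= f x)%E -> (forall x, f x <= g x)%E ->
  (\int[@lebesgue_measure R]_x f x <= \int[@lebesgue_measure R]_x g x)%E.
Proof.
move=> f0 fg; have g0 x : (0 <= g x)%E by exact: le_trans (f0 x) (fg x).
rewrite !ge0_integralTE//; apply: ereal_sup_le => _ [h hf <-].
by exists h => // x; exact: le_trans (hf x) (fg x).
Qed.

Lemma int_rV_ge0 (d : nat) (f : 'rV[R]_d -> \bar R) :
  (forall v, 0 <= f v)%E -> (0 <= int_rV f)%E.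
Proof.
by elim: d f => [|d IHd] f f0 //=; apply: integral_ge0 => x _; exact: IHd.
Qed.

Lemma le_int_rV (d : nat) (f g : 'rV[R]_d -> \bar R) :
  (forall v, 0 <= f v)%E -> (forall v, f v <= g v)%E ->
  (int_rV f <= int_rV g)%E.
Proof.
elim: d f g => [|d IHd] f g f0 fg //=; apply: ge0_le_integralT => x.
  exact: int_rV_ge0.
exact: IHd.
Qed.

Lemma int_out_ge0 (dx dy T : nat)
    (f : seq ('rV[R]_dx * 'rV[R]_dy) -> \bar R) :
  (forall s, 0 <= f s)%E -> (0 <= int_out T f)%E.
Proof.
elim: T f => [|T IHT] f f0 //=.
by apply: int_rV_ge0 => a; apply: int_rV_ge0 => b; exact: IHT.
Qed.

(** The Rényi integrand is only ever compared with an integrable majorant through this monotonicity;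
    its own measurability is never established. *)
Lemma le_int_out (dx dy T : nat)
    (f g : seq ('rV[R]_dx * 'rV[R]_dy) -> \bar R) :
  (forall s, 0 <= f s)%E -> (forall s, f s <= g s)%E ->
  (int_out T f <= int_out T g)%E.
Proof.
elim: T f g => [|T IHT] f g f0 fg //=; apply: le_int_rV => a.
  by apply: int_rV_ge0 => b; exact: int_out_ge0.
by apply: le_int_rV => b; [exact: int_out_ge0|exact: IHT].
Qed.

(** The free constant [c] carries the induction: it absorbs the factor of the first round before the
    remaining rounds are integrated. *)
Lemma int_out_prod (dx dy T : nat) (c : R) (F : 'rV[R]_dx * 'rV[R]_dy -> R)
    (I : R) : round_integral F I ->
  int_out T (fun s => (c * \prod_(o <- s) F o)%:E) = (c * I ^+ T)%:E.
Proof.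
move=> FI; elim: T c => [|T IHT] c /=; first by rewrite big_nil expr0.
transitivity (int_rV (fun a : 'rV[R]_dx => int_rV (fun b : 'rV[R]_dy =>
    (c * I ^+ T * F (a, b))%:E))).
  congr int_rV; apply: funext => a; congr int_rV; apply: funext => b.
  under [X in int_out _ X]eq_fun do rewrite big_cons mulrA.
  by rewrite IHT mulrAC.
have [J [FJ JI]] := round_integralZ (c * I ^+ T) FI.
rewrite exprSr mulrA -(eq_rV_integral JI); congr int_rV.
by apply: funext => a; rewrite -(eq_rV_integral (FJ a)).
Qed.

End IntegralPredicates.

(** * Gaussian densities and moments of their likelihood ratios *)

Section Gaussians.
Context {R : realType}.

Lemma sqnorm2_vcons (d : nat) (x : R) (v : 'rV[R]_d) (m : 'rV[R]_d.+1) :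
  sqnorm2 (vcons x v - m) =
  (x - m ord0 ord0) ^+ 2 + sqnorm2 (v - \row_j m ord0 (lift ord0 j)).
Proof.
rewrite /sqnorm2 big_ord_recl !mxE unlift_none; congr (_ + _).
by apply: eq_bigr => i _; rewrite !mxE liftK.
Qed.

Lemma gauss_pdf_vcons (d : nat) (s x : R) (v : 'rV[R]_d) (m : 'rV[R]_d.+1) :
  s != 0 ->
  gauss_pdf s (vcons x v - m) =
  normal_pdf (m ord0 ord0) s x *
    gauss_pdf s (v - \row_j m ord0 (lift ord0 j)).
Proof.
move=> s0; rewrite normal_pdfE// /gauss_pdf sqnorm2_vcons.
rewrite [- (_ + sqnorm2 _)]opprD [(- _ - sqnorm2 _) / _]mulrDl expRD.
rewrite /normal_fun /normal_peak exprS invfM.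
rewrite (_ : s ^+ 2 *+ 2 = 2 * s ^+ 2); last by rewrite mulr_natl.
rewrite (_ : s ^+ 2 * pi *+ 2 = 2 * pi * s ^+ 2).
  by ring.
by rewrite -mulr_natl; ring.
Qed.

Lemma rV_integral_gauss (d : nat) (s : R) (m : 'rV[R]_d) : s != 0 ->
  rV_integral (fun v => gauss_pdf s (v - m)) 1.
Proof.
move=> s0; elim: d m => [|d IHd] m /=.
  by rewrite /gauss_pdf /sqnorm2 big_ord0 oppr0 mul0r expR0 expr0 invr1 mulr1.
exists (fun x => normal_pdf (m ord0 ord0) s x); split=> [x|].
  under eq_fun do rewrite gauss_pdf_vcons//.
  by rewrite -[X in rV_integral _ X]mulr1; exact: rV_integralZ.
by split; [exact: integrable_normal_pdf|exact: integral_normal_pdf].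
Qed.

Lemma round_integral_gauss (dx dy : nat) (s t : R) (m : 'rV[R]_dx)
    (l : 'rV[R]_dy) : s != 0 -> t != 0 ->
  round_integral (fun o => gauss_pdf s (o.1 - m) * gauss_pdf t (o.2 - l)) 1.
Proof.
move=> s0 t0; exists (fun a => gauss_pdf s (a - m)); split=> [a|] /=.
  rewrite -[X in rV_integral _ X]mulr1; apply: rV_integralZ.
  exact: rV_integral_gauss.
exact: rV_integral_gauss.
Qed.

Lemma gauss_pdf_gt0 (d : nat) (s : R) (v : 'rV[R]_d) : s != 0 ->
  0 < gauss_pdf s v.
Proof.
move=> s0; rewrite mulr_gt0 ?expR_gt0// invr_gt0 exprn_gt0// sqrtr_gt0.
by apply: mulr_gt0; [rewrite mulr_gt0 ?pi_gt0|rewrite exprn_even_gt0].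
Qed.

Lemma expRM_int (x : R) (k : int) : expR x ^ k = expR (k%:~R * x).
Proof.
case: k => k; first by rewrite -exprnP mulrC expRM_natr.
by rewrite NegzE -exprnN mulrNz mulNr expRN mulrC expRM_natr.
Qed.

(* Completing the square:
   (1 - k) |v|^2 + k |v - c|^2 = |v - k c|^2 + k (1 - k) |c|^2. *)
Lemma gauss_pdf_ratio (d : nat) (s : R) (v c : 'rV[R]_d) (k : int) : s != 0 ->
  gauss_pdf s v * (gauss_pdf s (v - c) / gauss_pdf s v) ^ k =
  expR (k%:~R * (k%:~R - 1) / 2 * (sqnorm2 c / s ^+ 2)) *
    gauss_pdf s (v - k%:~R *: c).
Proof.
move=> s0.
have gp := gauss_pdf_gt0 (0 : 'rV[R]_d) s0.
set z := (Num.sqrt (2 * pi * s ^+ 2)) ^- d.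
have zn0 : z != 0.
  apply/negP => /eqP z0; move: gp.
  by rewrite /gauss_pdf -/z z0 mul0r ltxx.
rewrite /gauss_pdf -/z.
have -> (a b : R) : z * expR a / (z * expR b) = expR (a - b).
  by rewrite expRB; field; rewrite zn0 gt_eqF ?expR_gt0.
rewrite expRM_int -(mulrA z) [RHS]mulrCA -!expRD; congr (z * expR _).
have sqB a : sqnorm2 (v - a *: c) =
    sqnorm2 v - 2 * a * (\sum_(i < d) v ord0 i * c ord0 i) + a ^+ 2 * sqnorm2 c.
  rewrite /sqnorm2 !mulr_sumr -sumrB -big_split /=; apply: eq_bigr => i _.
  by rewrite !mxE; ring.
have := sqB 1; rewrite scale1r => ->; rewrite sqB.
by field.
Qed.

(** The ratio factors over features and labels. Completing the square in each leaves a product of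
    Gaussians of mass 1, and the two exponents add up. *)
Lemma round_integral_gauss_ratio (dx dy : nat) (s t : R) (m c : 'rV[R]_dx)
    (l e : 'rV[R]_dy) (k : int) : s != 0 -> t != 0 ->
  let B o := gauss_pdf s (o.1 - m) * gauss_pdf t (o.2 - l) in
  let B' o := gauss_pdf s (o.1 - m - c) * gauss_pdf t (o.2 - l - e) in
  round_integral (fun o => B o * (B' o / B o) ^ k)
    (expR (k%:~R * (k%:~R - 1) / 2 *
           (sqnorm2 c / s ^+ 2 + sqnorm2 e / t ^+ 2))).
Proof.
move=> s0 t0 /=.
rewrite (_ : (fun o => _) = (fun o => expR (k%:~R * (k%:~R - 1) / 2 *
    (sqnorm2 c / s ^+ 2 + sqnorm2 e / t ^+ 2)) *
    (gauss_pdf s (o.1 - (m + k%:~R *: c)) *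
     gauss_pdf t (o.2 - (l + k%:~R *: e))))).
  rewrite -[X in round_integral _ X]mulr1.
  by apply: round_integralZ; exact: round_integral_gauss.
apply: funext => -[a b] /=.
have unit_gauss d (z : R) (v : 'rV[R]_d) : z != 0 ->
    gauss_pdf z v \is a GRing.unit.
  by move=> z0; rewrite unitfE gt_eqF ?gauss_pdf_gt0.
rewrite -mulf_div exprzMl; try by rewrite unitrM unitrV !unit_gauss.
rewrite [LHS]mulrACA (gauss_pdf_ratio _ c)// (gauss_pdf_ratio _ e)//.
by rewrite [LHS]mulrACA -expRD -mulrDr -!addrA -!opprD.
Qed.

End Gaussians.

(** * Joint convexity and the scalar inequality for removal *)

Section Inequalities.
Context {R : realType}.

(** A convex power lies above its tangent at [c]; each induction step loses exactly a nonnegative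
    multiple of (z - c)^2. *)
Lemma bernoulli_tangent (a : nat) (z c : R) : 0 <= z -> 0 <= c ->
  c ^+ a.+1 + a.+1%:R * c ^+ a * (z - c) <= z ^+ a.+1.
Proof.
move=> z0 c0; elim: a => [|a IHa]; first by rewrite !expr1 expr0; lra.
rewrite (exprS z); apply: le_trans (ler_wpM2l z0 IHa).
rewrite -subr_ge0 (_ : _ - _ = a.+1%:R * c ^+ a * (z - c) ^+ 2).
  by rewrite mulr_ge0 ?sqr_ge0// mulr_ge0 ?exprn_ge0.
by rewrite !exprS -[a.+2%:R]natr1 expr0; ring.
Qed.

(** Take the tangent at c = P/Q, evaluate it at the A_i/B_i and average with weights w_i B_i: the
    linear term vanishes because P - c Q = 0. If Q = 0, the left-hand side is 0. *)
Lemma power_ratio_joint_convex (I : finType) (w A B : I -> R) (a : nat) :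
  (0 < a)%N ->
  (forall i, 0 <= w i) -> (forall i, 0 <= A i) -> (forall i, 0 < B i) ->
  ((\sum_i w i * A i) / \sum_i w i * B i) ^+ a * (\sum_i w i * B i) <=
  \sum_i w i * ((A i / B i) ^+ a * B i).
Proof.
case: a => // a _ w0 A0 B0.
set P := \sum_i w i * A i; set Q := \sum_i w i * B i.
have Q0 : 0 <= Q by rewrite sumr_ge0// => i _; rewrite mulr_ge0// ltW.
have P0 : 0 <= P by rewrite sumr_ge0// => i _; rewrite mulr_ge0.
have [Q00|Qn0] := eqVneq Q 0.
  rewrite Q00 mulr0 sumr_ge0// => i _.
  by rewrite !mulr_ge0 ?exprn_ge0 ?divr_ge0// ltW.
set c := P / Q.
have c0 : 0 <= c by rewrite divr_ge0.
apply: (@le_trans _ _ (\sum_i w i * ((c ^+ a.+1 + a.+1%:R * c ^+ a *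
    (A i / B i - c)) * B i))); last first.
  apply: ler_sum => i _; apply: ler_wpM2l => //; apply: ler_wpM2r.
    exact: ltW.
  by apply: bernoulli_tangent => //; rewrite divr_ge0// ltW.
rewrite (eq_bigr (fun i => c ^+ a.+1 * (w i * B i) + a.+1%:R * c ^+ a *
    (w i * A i) - a.+1%:R * c ^+ a * c * (w i * B i))); last first.
  by move=> i _; field; rewrite gt_eqF.
rewrite sumrB big_split /= -!mulr_sumr -/P -/Q.
have cQ : c * Q = P by rewrite divfK.
by rewrite -(mulrA _ c) cQ addrK.
Qed.

(* The recursion comes from (u - 1) A = u^(n+1) - u^(-n) and
   B = u^n + u^(-n), with t = (u - 1)^2 / u = u + 1/u - 2. *)
Fixpoint symm_polys (n : nat) : {poly R} * {poly R} :=
  if n is n'.+1 then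
    let: (A, B) := symm_polys n' in
    let B' := 'X * A + B in (A + B', B')
  else (1, 2%:R).

Definition symm_poly (n : nat) : {poly R} := (symm_polys n).1.

(** Dividing the right-hand side by u - 1 gives the sum of u^k over -n <= k <= n. This is invariant
    under u -> 1/u, hence a polynomial in u + 1/u. *)
Lemma symm_polyE (n : nat) (u : R) : 0 < u ->
  (u - 1) * (symm_poly n).[(u - 1) ^+ 2 / u] = u ^+ n.+1 - u ^- n.
Proof.
move=> u0; have un0 : u != 0 by rewrite gt_eqF.
suff [] : (u - 1) * (symm_poly n).[(u - 1) ^+ 2 / u] = u ^+ n.+1 - u ^- n /\
  (symm_polys n).2.[(u - 1) ^+ 2 / u] = u ^+ n + u ^- n by [].
rewrite /symm_poly; elim: n => [|n] /=.
  by rewrite -polyC_natr !hornerE; split; field.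
case: (symm_polys n) => A B /= [EA EB].
have EB' : ('X * A + B).[(u - 1) ^+ 2 / u] = u ^+ n.+1 + u ^- n.+1.
  rewrite !hornerE EB.
  rewrite (_ : _ / u * _ = (u - 1) / u * ((u - 1) * A.[(u - 1) ^+ 2 / u]));
    last by ring.
  by rewrite EA !exprS; field; rewrite un0 expf_neq0.
split=> //; rewrite hornerD EB' mulrDr EA !exprS; field.
by rewrite un0 expf_neq0.
Qed.

Lemma symm_poly_ge0 (n i : nat) : 0 <= (symm_poly n)`_i.
Proof.
suff [] : 0 <= (symm_poly n)`_i /\ 0 <= (symm_polys n).2`_i by [].
rewrite /symm_poly; elim: n i => [|n IHn] i /=.
  by rewrite coefMn coef1; split; rewrite ?mulrn_wge0// ler0n.
move: IHn; case: (symm_polys n) => A B /= IHn.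
have nB' : 0 <= ('X * A + B)`_i.
  rewrite coefD coefXM addr_ge0 ?(IHn i).2//.
  by case: ifP => // _; rewrite (IHn _).1.
by rewrite coefD addr_ge0 ?(IHn i).1.
Qed.

Lemma le_symm_poly (n : nat) (x y : R) : 0 <= x -> x <= y ->
  (symm_poly n).[x] <= (symm_poly n).[y].
Proof.
move=> x0 xy; rewrite !horner_coef; apply: ler_sum => i _.
by rewrite ler_wpM2l ?symm_poly_ge0// lerXn2r// nnegrE (le_trans x0).
Qed.

(* With u = 1 - p + p r and Psi = symm_poly n, the two sides differ by
   (u - 1) (Psi((u - 1)^2 / u) - Psi((u - 1)^2 / r)), and u lies between 1
   and r. *)
Lemma inv_power_le (p r : R) (n : nat) : 0 <= p -> p <= 1 -> 0 < r ->
  (1 - p + p * r) ^- n <= (1 - p + p * r) ^+ n.+1 -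
    p * (r - 1) * (symm_poly n).[p ^+ 2 * ((r - 1) ^+ 2 / r)].
Proof.
move=> p0 p1 r0; set u := 1 - p + p * r.
have u0 : 0 < u.
  have [p00|pn0] := eqVneq p 0; first by rewrite /u p00; lra.
  have pgt : 0 < p by rewrite lt_def pn0.
  by rewrite /u; have := mulr_gt0 pgt r0; lra.
rewrite lerBrDr addrC -lerBrDr -symm_polyE//.
have -> : p ^+ 2 * ((r - 1) ^+ 2 / r) = (u - 1) ^+ 2 / r.
  by rewrite /u; field; rewrite gt_eqF.
have -> : p * (r - 1) = u - 1 by rewrite /u; ring.
have [r1|r1] := leP 1 r.
  have u1 : 0 <= u - 1.
    rewrite (_ : u - 1 = p * (r - 1)); last by rewrite /u; ring.
    by rewrite mulr_ge0 ?subr_ge0.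
  rewrite ler_wpM2l// le_symm_poly//; first by rewrite divr_ge0 ?sqr_ge0 ?ltW.
  rewrite ler_wpM2l ?sqr_ge0// lef_pV2 ?posrE//.
  rewrite -subr_ge0 (_ : r - u = (1 - p) * (r - 1)); last by rewrite /u; ring.
  by rewrite mulr_ge0 ?subr_ge0.
have u1 : u - 1 <= 0.
  rewrite (_ : u - 1 = - (p * (1 - r))); last by rewrite /u; ring.
  by rewrite oppr_le0 mulr_ge0 ?subr_ge0 // ltW.
rewrite ler_wnM2l// le_symm_poly//; first by rewrite divr_ge0 ?sqr_ge0 ?ltW.
rewrite ler_wpM2l ?sqr_ge0// lef_pV2 ?posrE//.
rewrite -subr_ge0 (_ : u - r = (1 - p) * (1 - r)); last by rewrite /u; ring.
by rewrite mulr_ge0 ?subr_ge0 // ltW.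
Qed.

End Inequalities.

(** * Gaussian moments and the closed form of the bound *)

Section Moments.
Context {R : realType}.

(* E_Q[(dP/dQ)^k] for unit-covariance Gaussians whose means are at squared
   distance D. *)
Definition gauss_moment (D : R) (k : int) : R :=
  expR (k%:~R * (k%:~R - 1) / 2 * D).

Definition mix_moment (p D : R) (a : nat) : R :=
  \sum_(l < a.+1) 'C(a, l)%:R * (1 - p) ^+ (a - l) * p ^+ l *
    gauss_moment D l.

(** Since B (B'/B)^(1-k) = B' (B/B')^k, the reflection exchanges the two Gaussians, which leaves
    their distance unchanged. *)
Lemma gauss_moment_reflect (D : R) (k : int) :
  gauss_moment D (1 - k) = gauss_moment D k.
Proof. by rewrite /gauss_moment rmorphB /=; congr expR; ring. Qed.

Lemma gauss_moment_ge1 (D : R) (l : nat) : 0 <= D -> 1 <= gauss_moment D l.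
Proof.
move=> D0; rewrite -expR0 ler_expR mulr_ge0// divr_ge0//.
case: l => [|l]; first by rewrite mul0r.
by rewrite mulr_ge0 ?ler0z// subr_ge0 ler1z.
Qed.

(** Every moment is at least 1, so the sum dominates the binomial expansion of ((1 - p) + p)^a =
    1. *)
Lemma mix_moment_ge1 (p D : R) (a : nat) :
  0 <= p -> p <= 1 -> 0 <= D -> 1 <= mix_moment p D a.
Proof.
move=> p0 p1 D0; have q0 : 0 <= 1 - p by rewrite subr_ge0.
rewrite -{1}(expr1n _ a) -{1}(subrK p 1) exprDn; apply: ler_sum => l _.
rewrite -mulr_natl mulrA -[leLHS]mulr1 ler_wpM2l ?gauss_moment_ge1//.
by rewrite !mulr_ge0 ?exprn_ge0.
Qed.

(** The terms l = 0 and l = 1 have moment 1 and merge into the first summand. For l >= 2, the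
    exponent l (l - 1) D / 2 is bounded using l <= a and D <= d. *)
Lemma mix_moment_le (p D d : R) (a : nat) :
  (2 <= a)%N -> 0 <= p -> p <= 1 -> 0 <= D -> D <= d ->
  mix_moment p D a <=
  (1 - p) ^+ (a - 1) * (a%:R * p - p + 1) +
  \sum_(2 <= l < a.+1) 'C(a, l)%:R * (1 - p) ^+ (a - l) * p ^+ l *
    expR ((l%:R - 1) * (a%:R / 2 * d)).
Proof.
case: a => [//|[//|a]] _ p0 p1 D0 Dd.
have q0 : 0 <= 1 - p by rewrite subr_ge0.
rewrite /mix_moment -(big_mkord xpredT (fun l : nat =>
  'C(a.+2, l)%:R * (1 - p) ^+ (a.+2 - l) * p ^+ l * gauss_moment D l)).
rewrite big_nat_recl// big_nat_recl// addrA [X in X + _](_ : _ =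
  (1 - p) ^+ (a.+2 - 1) * (a.+2%:R * p - p + 1)); last first.
  rewrite bin0 bin1 /gauss_moment !mul0r expR0 subrr mulr0 !mul0r expR0.
  by rewrite subn0 subn1 /= expr0 expr1 [(1 - p) ^+ a.+2]exprS; ring.
rewrite lerD2l (big_addn 0 _ 2) subn2 /= !big_mkord; apply: ler_sum => l _.
rewrite addn2; apply: ler_wpM2l.
  by apply: mulr_ge0; [apply: mulr_ge0 => //|]; exact: exprn_ge0.
rewrite /gauss_moment ler_expR.
have l0 : 0 <= l%:R :> R by exact: ler0n.
have la : l%:R <= a%:R :> R by rewrite ler_nat -ltnS ltn_ord.
rewrite (_ : (Posz l.+2)%:~R = l%:R + 2 :> R); last first.
  by rewrite -addn2 PoszD rmorphD.
rewrite -[l.+2%:R]natr1 -[l.+1%:R]natr1 -[a.+2%:R]natr1 -[a.+1%:R]natr1.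
have ld : (l%:R + 2) * D <= (a%:R + 2) * d.
  by apply: ler_pM => //; lra.
nra.
Qed.

End Moments.

(** * Integrals of the binomial and corrected majorants *)

Section MixtureIntegrals.
Context {R : realType} {dx dy : nat}.
Local Notation out := ('rV[R]_dx * 'rV[R]_dy)%type.
Variables (D p : R) (B r : out -> R).
Hypothesis r_gt0 : forall o, 0 < r o.
Hypothesis Br_int : forall k : int,
  round_integral (fun o => B o * r o ^ k) (gauss_moment D k).

Lemma round_integral_mix (a : nat) :
  round_integral (fun o => B o * (1 - p + p * r o) ^+ a) (mix_moment p D a).
Proof.
pose c (l : 'I_a.+1) := 'C(a, l)%:R * (1 - p) ^+ (a - l) * p ^+ l.
have -> : (fun o => B o * (1 - p + p * r o) ^+ a) =
    (fun o => \sum_l c l * (B o * r o ^ (l : nat))).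
  apply: funext => o; rewrite exprDn mulr_sumr; apply: eq_bigr => l _.
  by rewrite /c -exprnP exprMn -mulr_natl; ring.
by apply: (round_integral_sum _ c) => l _; exact: Br_int.
Qed.

(* The moments of r^i and r^(1 - i) agree, so the terms of the binomial
   expansion cancel in pairs. *)
Lemma round_integral_odd (j : nat) :
  round_integral (fun o => B o * ((r o - 1) ^+ j.*2.+1 / r o ^+ j)) 0.
Proof.
pose c (i : nat) : R := (-1) ^+ (j.*2.+1 - i) * 'C(j.*2.+1, i)%:R.
have -> : (fun o => B o * ((r o - 1) ^+ j.*2.+1 / r o ^+ j)) =
    (fun o => \sum_(i < j.*2.+2) c i * (B o * r o ^ (i%:Z - j%:Z))).
  apply: funext => o; rewrite addrC exprDn mulr_suml mulr_sumr.
  apply: eq_bigr => i _.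
  rewrite exprzDr ?unitfE ?gt_eqF// -exprnN -exprnP /c -mulr_natl; ring.
suff S0 : \sum_(i < j.*2.+2) c i * gauss_moment D (i%:Z - j%:Z) = 0.
  rewrite -[X in round_integral _ X]S0.
  by apply: (round_integral_sum _ (fun i : 'I_ _ => c i)) => i _; exact: Br_int.
set S := (LHS).
(* The reversal i -> 2j+1-i turns the exponent i - j into 1 - (i - j), where the moment is the same,
   and flips the sign because 2j+1 is odd. *)
have SN : S = - S.
  rewrite {1}/S (reindex_inj rev_ord_inj) /= -sumrN; apply: eq_bigr => i _.
  have iN : (i <= j.*2.+1)%N by rewrite -ltnS ltn_ord.
  have idx (k : nat) : (k <= j.*2.+1)%N ->
      1 - ((j.*2.+1 - k)%N%:Z - j%:Z) = k%:Z - j%:Z.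
    by move=> kN; rewrite -subzn// -addnn -addn1 !PoszD; ring.
  have sgn (k : nat) : (k <= j.*2.+1)%N ->
      (-1) ^+ k = - (-1) ^+ (j.*2.+1 - k) :> R.
    move=> kN; rewrite -signr_odd -[in RHS]signr_odd oddB//= odd_double /=.
    by case: (odd k); rewrite /= ?expr0 ?expr1 ?opprK.
  rewrite subSS /c subKn// bin_sub// -gauss_moment_reflect idx// sgn//.
  by rewrite !mulNr.
by have := SN; lra.
Qed.

(** The i-th term of the correction is a constant times (r - 1)^(2i+1) / r^i, which integrates to 0
    by [round_integral_odd]. *)
Lemma round_integral_mix_corrected (n : nat) :
  round_integral (fun o => B o * ((1 - p + p * r o) ^+ n.+1 -
    p * (r o - 1) * (symm_poly n).[p ^+ 2 * ((r o - 1) ^+ 2 / r o)]))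
  (mix_moment p D n.+1).
Proof.
pose c i : R := - (p ^+ i.*2.+1 * (symm_poly n)`_i).
have : round_integral (fun o => \sum_(i < size (symm_poly n : {poly R}))
    c i * (B o * ((r o - 1) ^+ i.*2.+1 / r o ^+ i))) 0.
  rewrite [X in round_integral _ X](_ : 0 =
      \sum_(i < size (symm_poly n : {poly R})) c i * 0).
    by apply: (round_integral_sum _ (fun i : 'I_ _ => c i)) => i _;
      exact: round_integral_odd.
  by rewrite big1// => i _; rewrite mulr0.
move=> /(linear_round_integral 1 (round_integral_mix n.+1)).
rewrite addr0 mul1r; congr round_integral; apply: funext => o.
rewrite mul1r mulrBr; congr (_ + _).
rewrite horner_coef 2!mulr_sumr -sumrN; apply: eq_bigr => i _.
rewrite /c exprMn expr_div_n -!exprM -mul2n !exprS; ring.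
Qed.

End MixtureIntegrals.

(** * Poisson sampling and the insertion of a record *)

Section PoissonSampling.
Context {R : realType} {A : Type} {V : zmodType}.
Variables (p : R) (h : A -> V).

Definition subset_weight (n : nat) (b : n.-tuple bool) : R :=
  p ^+ count id b * (1 - p) ^+ (n - count id b).

(** The expectation of [phi] at the sum over a Poisson subsample. A general group [V] lets features
    and labels be summed as one pair. *)
Definition poisson_mean (s : seq A) (phi : V -> R) : R :=
  \sum_(b : (size s).-tuple bool)
    subset_weight b * phi (\sum_(r <- mask b s) h r).

Lemma sum_tuple_cons (n : nat) (F : n.+1.-tuple bool -> R) :
  \sum_t F t = \sum_(t : n.-tuple bool) F [tuple of false :: t] +
               \sum_(t : n.-tuple bool) F [tuple of true :: t].
Proof.
rewrite (reindex (fun x : bool * n.-tuple bool => [tuple of x.1 :: x.2])) /=.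
  rewrite -(pair_big xpredT xpredT (fun b (t : n.-tuple bool) =>
    F [tuple of b :: t])) /=.
  by rewrite big_bool /= addrC.
exists (fun t : n.+1.-tuple bool => (thead t, [tuple of behead t])).
  by move=> [b t] _; congr pair; apply: val_inj.
by move=> t _; rewrite -tuple_eta.
Qed.

Lemma poisson_mean_cons (a : A) (s : seq A) (phi : V -> R) :
  poisson_mean (a :: s) phi =
  (1 - p) * poisson_mean s phi + p * poisson_mean s (fun v => phi (v + h a)).
Proof.
rewrite /poisson_mean /= sum_tuple_cons !mulr_sumr; congr (_ + _);
  apply: eq_bigr => b _; rewrite /subset_weight /=.
  have cb : (count id b <= size s)%N.
    by rewrite -[X in (_ <= X)%N](size_tuple b) count_size.
  by rewrite add0n subSn// exprS; ring.
by rewrite add1n subSS exprS big_cons [h a + _]addrC !mulrA.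
Qed.

(** Conditioning on whether [a] is sampled. Commutativity of the sum moves [a] past the prefix, with
    [phi] general to absorb the shifts. *)
Lemma poisson_mean_insert (s1 s2 : seq A) (a : A) (phi : V -> R) :
  poisson_mean (s1 ++ a :: s2) phi =
  (1 - p) * poisson_mean (s1 ++ s2) phi +
  p * poisson_mean (s1 ++ s2) (fun v => phi (v + h a)).
Proof.
elim: s1 phi => [|b s1 IHs] phi /=; first exact: poisson_mean_cons.
rewrite !poisson_mean_cons !IHs.
have -> : (fun v => phi (v + h a + h b)) = (fun v => phi (v + h b + h a)).
  by apply: funext => v; rewrite addrAC.
ring.
Qed.

Lemma sum_subset_weight (n : nat) :
  \sum_(b : n.-tuple bool) subset_weight b = 1.
Proof.
elim: n => [|n IHn].
  rewrite (big_pred1 (nil_tuple bool)) => [|b]; last first.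
    by apply/esym/eqP/val_inj; case: b => -[].

  by rewrite /subset_weight /= !expr0 mulr1.
transitivity ((1 - p) * (\sum_(b : n.-tuple bool) subset_weight b) +
              p * \sum_(b : n.-tuple bool) subset_weight b).
  rewrite sum_tuple_cons !mulr_sumr.
  congr (_ + _); apply: eq_bigr => b _; rewrite /subset_weight /=.
    have cb : (count id b <= n)%N.
      by rewrite -[X in (_ <= X)%N](size_tuple b) count_size.
    by rewrite add0n subSn// exprS; ring.
  by rewrite add1n subSS exprS mulrA.
by rewrite IHn; ring.
Qed.

Lemma subset_weight_ge0 (n : nat) (b : n.-tuple bool) :
  0 <= p -> p <= 1 -> 0 <= subset_weight b.
Proof. by move=> p0 p1; rewrite mulr_ge0 ?exprn_ge0 ?subr_ge0. Qed.

End PoissonSampling.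

(** * Majorants for one round, in both directions *)

Section MixtureBounds.
Context {R : realType} {dx dy : nat}.
Local Notation out := ('rV[R]_dx * 'rV[R]_dy)%type.
Variables (D p : R) (I : finType) (w : I -> R) (B r : I -> out -> R).
Hypothesis p0 : 0 <= p.
Hypothesis p1 : p <= 1.
Hypothesis w_ge0 : forall i, 0 <= w i.
Hypothesis w_sum1 : \sum_i w i = 1.
Hypothesis B_gt0 : forall i o, 0 < B i o.
Hypothesis r_gt0 : forall i o, 0 < r i o.
Hypothesis Br_int : forall i (k : int),
  round_integral (fun o => B i o * r i o ^ k) (gauss_moment D k).

Let u i o := 1 - p + p * r i o.

Let u_gt0 i o : 0 < u i o.
Proof.
have [p00|pn0] := eqVneq p 0; first by rewrite /u p00; lra.
have pgt : 0 < p by rewrite lt_def pn0.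
by rewrite /u; have := mulr_gt0 pgt (r_gt0 i o); have := p1; lra.
Qed.

(** Joint convexity reduces to the components, where the ratio is u_i. Each B_i u_i^a has the same
    integral, and the weights sum to 1. *)
Lemma add_record_bound (a : nat) : (0 < a)%N ->
  exists2 G, round_integral G (mix_moment p D a) &
  forall o, ((\sum_i w i * (B i o * (1 - p + p * r i o))) /
             (\sum_i w i * B i o)) ^+ a * (\sum_i w i * B i o) <= G o.
Proof.
move=> a0; exists (fun o => \sum_i w i * (B i o * u i o ^+ a)) => [|o].
  rewrite -[mix_moment _ _ _]mul1r -[X in X * mix_moment _ _ _]w_sum1 mulr_suml.
  by apply: (round_integral_sum _ w) => i _; exact: round_integral_mix.
apply: le_trans (power_ratio_joint_convex _ _ _ _) _ => //= [i|].
  by rewrite mulr_ge0// ltW// u_gt0.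
apply: ler_sum => i _; apply: ler_wpM2l => //.
by rewrite [B i o * _]mulrC mulfK ?gt_eqF// mulrC.
Qed.

(** On a component the integrand is B_i u_i^(1-a); [inv_power_le] replaces it by the corrected
    majorant, whose integral is known exactly. *)
Lemma remove_record_bound (a : nat) : (0 < a)%N ->
  exists2 G, round_integral G (mix_moment p D a) &
  forall o, ((\sum_i w i * B i o) /
             (\sum_i w i * (B i o * (1 - p + p * r i o)))) ^+ a *
            (\sum_i w i * (B i o * (1 - p + p * r i o))) <= G o.
Proof.
case: a => // n _; exists (fun o => \sum_i w i * (B i o * (u i o ^+ n.+1 -
    p * (r i o - 1) *
      (symm_poly n).[p ^+ 2 * ((r i o - 1) ^+ 2 / r i o)]))) => [|o].
  rewrite -[mix_moment _ _ _]mul1r -[X in X * mix_moment _ _ _]w_sum1 mulr_suml.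
  apply: (round_integral_sum _ w) => i _.
  exact: round_integral_mix_corrected.
apply: le_trans (power_ratio_joint_convex _ _ _ _) _ => //= [i|i|].
- exact: ltW.
- by rewrite mulr_gt0// u_gt0.
apply: ler_sum => i _; apply: ler_wpM2l => //.
have -> : (B i o / (B i o * (1 - p + p * r i o))) ^+ n.+1 *
    (B i o * (1 - p + p * r i o)) = B i o * u i o ^- n.
  have un0 : u i o != 0 by rewrite gt_eqF.
  rewrite -/(u i o) -{1}[B i o]mulr1 -mulf_div divff ?gt_eqF// !mul1r.
  by rewrite exprVn exprS; field; rewrite expf_neq0.
by apply: ler_wpM2l; [exact: ltW|exact: inv_power_le].
Qed.

End MixtureBounds.

(** * Composition of the T independent rounds *)

Section Composition.
Context {R : realType} {dx dy : nat}.
Local Notation out := ('rV[R]_dx * 'rV[R]_dy)%type.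

(** The integrand is a product over rounds; majorising each factor by [G] bounds the integral by
    M^T, whose logarithm is T ln M. *)
Lemma renyi_div_prod (T a : nat) (P Q G : out -> R) (M : R) :
  (1 < a)%N -> (forall o, 0 <= P o) -> (forall o, 0 <= Q o) ->
  round_integral G M -> 1 <= M ->
  (forall o, (P o / Q o) ^+ a * Q o <= G o) ->
  (renyi_div (@int_out R dx dy T) a%:R
     (fun s : seq out => (\prod_(o <- s) P o)%R)
     (fun s => (\prod_(o <- s) Q o)%R) <= (T%:R / (a%:R - 1) * ln M)%R%:E)%E.
Proof.
move=> a1 P0 Q0 GM M1 PQG; rewrite /renyi_div.
have PQ0 o : 0 <= (P o / Q o) ^+ a * Q o.
  by rewrite mulr_ge0// exprn_ge0// divr_ge0.
have densE (s : seq out) : ((\prod_(o <- s) P o) / \prod_(o <- s) Q o)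
    `^ a%:R * \prod_(o <- s) Q o = \prod_(o <- s) ((P o / Q o) ^+ a * Q o).
  rewrite powR_mulrn; last by rewrite divr_ge0// prodr_ge0.
  by rewrite big_split /= prodrXl prodf_div.
under [X in int_out T X]eq_fun do rewrite densE.
have I0 : (0 <= int_out T (fun s : seq out =>
    (\prod_(o <- s) ((P o / Q o) ^+ a * Q o))%:E))%E.
  by apply: int_out_ge0 => s; rewrite lee_fin prodr_ge0.
have IM : (int_out T (fun s : seq out =>
    (\prod_(o <- s) ((P o / Q o) ^+ a * Q o))%:E) <= (M ^+ T)%:E)%E.
  rewrite -[M ^+ T]mul1r -(int_out_prod T 1 GM); apply: le_int_out => s.
    by rewrite lee_fin prodr_ge0.
  by rewrite lee_fin mul1r ler_prod// => o _; rewrite PQ0 PQG.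
(* The two bounds exclude both infinite values, so the +oo branch of [renyi_div] cannot occur. *)
move: I0 IM; case: (int_out _ _) => [x| |]//.
rewrite !lee_fin => x0 xM.
have a10 : 0 < a%:R - 1 :> R by rewrite subr_gt0 ltr1n.
rewrite mulrAC ler_pM2r ?invr_gt0// mulr_natl -lnXn; last by lra.
(* By convention [ln] is 0 at 0, so this case rests on M >= 1. *)
have [x00|xn0] := eqVneq x 0.
  by rewrite x00 ln0// ln_ge0// exprn_ege1.
have xgt : 0 < x by rewrite lt_def xn0.
by rewrite ler_ln ?posrE// (lt_le_trans xgt).
Qed.

End Composition.

(** * Norms of clipped vectors *)

Section Clipping.
Context {R : realType}.

Lemma sqnorm2_ge0 (d : nat) (v : 'rV[R]_d) : 0 <= sqnorm2 v.
Proof. by apply: sumr_ge0 => i _; rewrite sqr_ge0. Qed.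

Lemma sqnorm2Z (d : nat) (c : R) (v : 'rV[R]_d) :
  sqnorm2 (c *: v) = c ^+ 2 * sqnorm2 v.
Proof.
by rewrite /sqnorm2 mulr_sumr; apply: eq_bigr => i _; rewrite mxE exprMn.
Qed.

Lemma sqnorm2_clip_le (d : nat) (C : R) (v : 'rV[R]_d) : 0 < C ->
  sqnorm2 (clip C v) <= C ^+ 2.
Proof.
move=> C0; rewrite sqnorm2Z.
set N := Num.max 1 _.
have N1 : 1 <= N by rewrite le_max lexx.
have NC : norm2 v <= C * N.
  by rewrite -ler_pdivrMl// mulrC le_max lexx orbT.
have -> : sqnorm2 v = norm2 v ^+ 2 by rewrite sqr_sqrtr// sqnorm2_ge0.
rewrite exprVn mulrC ler_pdivrMr; last by rewrite exprn_gt0//; lra.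
rewrite -exprMn lerXn2r// nnegrE; first exact: sqrtr_ge0.
by rewrite mulr_ge0 ?ltW//; lra.
Qed.

End Clipping.

(** * The DPFMix mechanism *)

Section Mechanism.
Context {R : realType} {X : Type} {dx dy : nat}.
Local Notation out := ('rV[R]_dx * 'rV[R]_dy)%type.
Variables (f1 : X -> 'rV[R]_dx) (n m : nat) (sx sy Cx Cy : R).
Hypothesis mn : (1 <= m <= n)%N.
Hypothesis sx0 : 0 < sx.
Hypothesis sy0 : 0 < sy.
Hypothesis Cx0 : 0 < Cx.
Hypothesis Cy0 : 0 < Cy.

Let p : R := m%:R / n%:R.
Let tx : R := Cx * sx / m%:R.
Let ty : R := Cy * sy / m%:R.

Definition clip_record (r : X * 'rV[R]_dy) : out :=
  (clip Cx (f1 r.1), clip Cy r.2).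

(** Here [c] is the sum before division by m, so that sampling one more record is a translation of
    [c]. *)
Definition centered_gauss (o c : out) : R :=
  gauss_pdf tx (o.1 - m%:R^-1 *: c.1) * gauss_pdf ty (o.2 - m%:R^-1 *: c.2).

Lemma dpfmix_round_pdfE (S : seq (X * 'rV[R]_dy)) (o : out) :
  dpfmix_round_pdf f1 n m sx sy Cx Cy S o =
  poisson_mean p clip_record S (centered_gauss o).
Proof.
apply: eq_bigr => b _; rewrite /centered_gauss /=.
have -> : (\sum_(r <- mask b S) clip_record r).1 =
    \sum_(r <- mask b S) clip Cx (f1 r.1).
  by rewrite (big_morph fst (id1 := 0) (op1 := +%R)).
have -> : (\sum_(r <- mask b S) clip_record r).2 =
    \sum_(r <- mask b S) clip Cy r.2.
  by rewrite (big_morph snd (id1 := 0) (op1 := +%R)).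
by rewrite /subset_weight -!mulrA.
Qed.

Let m0 : 0 < m%:R :> R.
Proof. by rewrite ltr0n; case/andP: mn. Qed.

Let p0 : 0 <= p. Proof. by rewrite divr_ge0. Qed.

Let p1 : p <= 1.
Proof.
case/andP: mn => m1 lemn.
by rewrite ler_pdivrMr ?mul1r ?ler_nat// ltr0n (leq_trans m1).
Qed.

Let tx0 : tx != 0.
Proof. by rewrite !mulf_neq0 ?invr_neq0// gt_eqF. Qed.

Let ty0 : ty != 0.
Proof. by rewrite !mulf_neq0 ?invr_neq0// gt_eqF. Qed.

Lemma centered_gauss_gt0 (o c : out) : 0 < centered_gauss o c.
Proof. by rewrite mulr_gt0// gauss_pdf_gt0. Qed.

(** The quantity D for the record [r]: the squared normalised distance by which it moves the
    Gaussian mean. *)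
Definition record_shift (r : X * 'rV[R]_dy) : R :=
  sqnorm2 (m%:R^-1 *: (clip_record r).1) / tx ^+ 2 +
  sqnorm2 (m%:R^-1 *: (clip_record r).2) / ty ^+ 2.

Lemma record_shift_ge0 (r : X * 'rV[R]_dy) : 0 <= record_shift r.
Proof. by rewrite addr_ge0// divr_ge0 ?sqnorm2_ge0 ?sqr_ge0. Qed.

(** A clipped record moves the mean by at most C/m, against noise of deviation C s/m; C and m
    cancel. *)
Lemma record_shift_le (r : X * 'rV[R]_dy) :
  record_shift r <= (sx ^+ 2)^-1 + (sy ^+ 2)^-1.
Proof.
have shift_le d (C s : R) (v : 'rV[R]_d) : 0 < C -> 0 < s ->
    sqnorm2 (m%:R^-1 *: clip C v) / (C * s / m%:R) ^+ 2 <= (s ^+ 2)^-1.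
  move=> C0 s0; rewrite sqnorm2Z.
  rewrite (_ : _ / _ = sqnorm2 (clip C v) / C ^+ 2 * (s ^+ 2)^-1); last first.
    by field; rewrite !gt_eqF.
  rewrite ler_piMl ?invr_ge0 ?sqr_ge0//.
  by rewrite ler_pdivrMr ?exprn_gt0// mul1r sqnorm2_clip_le.
by rewrite lerD// shift_le.
Qed.

(** The value does not depend on [c], so all components of the mixture share one D. *)
Lemma centered_gauss_ratio_integral (r : X * 'rV[R]_dy) (c : out) (k : int) :
  round_integral (fun o => centered_gauss o c *
      (centered_gauss o (c + clip_record r) / centered_gauss o c) ^ k)
    (gauss_moment (record_shift r) k).
Proof.
have gaussD o : centered_gauss o (c + clip_record r) =
    gauss_pdf tx (o.1 - m%:R^-1 *: c.1 - m%:R^-1 *: (clip_record r).1) *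
    gauss_pdf ty (o.2 - m%:R^-1 *: c.2 - m%:R^-1 *: (clip_record r).2).
  by rewrite /centered_gauss [(_ + _).1]/= [(_ + _).2]/= !scalerDr !opprD
    !addrA.
under eq_fun do rewrite gaussD.
exact: round_integral_gauss_ratio.
Qed.

Lemma dpfmix_round_pdf_insert (s1 s2 : seq (X * 'rV[R]_dy))
    (r : X * 'rV[R]_dy) (o : out) :
  let c (b : (size (s1 ++ s2)).-tuple bool) :=
    \sum_(r <- mask b (s1 ++ s2)) clip_record r in
  dpfmix_round_pdf f1 n m sx sy Cx Cy (s1 ++ r :: s2) o =
  \sum_b subset_weight p b * (centered_gauss o (c b) * (1 - p + p *
    (centered_gauss o (c b + clip_record r) / centered_gauss o (c b)))).
Proof.
move=> c; rewrite dpfmix_round_pdfE poisson_mean_insert /poisson_mean.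
rewrite !mulr_sumr -big_split /=; apply: eq_bigr => b _; rewrite -/(c b).
by field; rewrite gt_eqF// centered_gauss_gt0.
Qed.

Lemma dpfmix_round_bound (S S' : seq (X * 'rV[R]_dy)) (a : nat) :
  (0 < a)%N -> neighbors S S' ->
  exists r G, round_integral G (mix_moment p (record_shift r) a) /\
    forall o, (dpfmix_round_pdf f1 n m sx sy Cx Cy S o /
               dpfmix_round_pdf f1 n m sx sy Cx Cy S' o) ^+ a *
              dpfmix_round_pdf f1 n m sx sy Cx Cy S' o <= G o.
Proof.
move=> a0 [s1 [r [s2 SS']]]; exists r.
pose c (b : (size (s1 ++ s2)).-tuple bool) :=
  \sum_(r <- mask b (s1 ++ s2)) clip_record r.
pose B b o := centered_gauss o (c b).
pose rho b o := centered_gauss o (c b + clip_record r) / B b o.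
have B0 b o : 0 < B b o by exact: centered_gauss_gt0.
have rho0 b o : 0 < rho b o by rewrite divr_gt0// centered_gauss_gt0.
have w0 b : 0 <= subset_weight p (b : (size (s1 ++ s2)).-tuple bool).
  exact: subset_weight_ge0.
have w1 := sum_subset_weight p (size (s1 ++ s2)).
have Bint b k : round_integral (fun o => B b o * rho b o ^ k)
    (gauss_moment (record_shift r) k) by exact: centered_gauss_ratio_integral.
(* In the first case [S] has the extra record, so the larger mixture is the numerator; in the second
   it is the denominator. *)
case: SS' => -[-> ->].
- have [G GM GP] := add_record_bound p0 p1 w0 w1 B0 rho0 Bint a0.
  exists G; split=> // o.
  by rewrite dpfmix_round_pdf_insert dpfmix_round_pdfE; exact: GP.
- have [G GM GP] := remove_record_bound p0 p1 w0 w1 B0 rho0 Bint a0.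
  exists G; split=> // o.
  by rewrite dpfmix_round_pdf_insert dpfmix_round_pdfE; exact: GP.
Qed.

Lemma dpfmix_round_pdf_ge0 (S : seq (X * 'rV[R]_dy)) (o : out) :
  0 <= dpfmix_round_pdf f1 n m sx sy Cx Cy S o.
Proof.
rewrite dpfmix_round_pdfE; apply: sumr_ge0 => b _.
by rewrite mulr_ge0 ?subset_weight_ge0// ltW// centered_gauss_gt0.
Qed.

Lemma dpfmix_renyi_le (T a : nat) (S S' : seq (X * 'rV[R]_dy)) :
  (2 <= a)%N -> neighbors S S' ->
  (renyi_div (@int_out R dx dy T) a%:R
     (dpfmix_pdf f1 n m sx sy Cx Cy S) (dpfmix_pdf f1 n m sx sy Cx Cy S')
   <= (eps_rdp n m sx sy T a)%:E)%E.
Proof.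
move=> a2 nSS'.
have [r [G [GM GP]]] := dpfmix_round_bound (ltnW a2) nSS'.
have M1 := mix_moment_ge1 a p0 p1 (record_shift_ge0 r).
apply: le_trans (renyi_div_prod T a2 _ _ GM M1 GP) _.
- by move=> o; exact: dpfmix_round_pdf_ge0.
- by move=> o; exact: dpfmix_round_pdf_ge0.
have a10 : 0 < a%:R - 1 :> R by rewrite subr_gt0 ltr1n.
(* The shift is replaced by its worst case only now: the cancellation of the correction needed the
   exact moments. *)
have Mle := mix_moment_le a2 p0 p1 (record_shift_ge0 r) (record_shift_le r).
rewrite lee_fin /eps_rdp -/p; apply: ler_wpM2l.
  by rewrite divr_ge0// ltW.
have epsE : a%:R / (2 * sx ^+ 2) + a%:R / (2 * sy ^+ 2) =
    a%:R / 2 * ((sx ^+ 2)^-1 + (sy ^+ 2)^-1) :> R.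
  by field; rewrite !gt_eqF.
rewrite epsE ler_ln// posrE; first by lra.
by apply: lt_le_trans Mle; lra.
Qed.

End Mechanism.

Unset Implicit Arguments.

Theorem mainTheorem3 (R : realType) (X : Type) (dx dy : nat)
  (f1 : X -> 'rV[R]_dx) (n m : nat) (sx sy Cx Cy : R) (T : nat) :
  (1 <= m <= n)%N -> 0 < sx -> 0 < sy -> 0 < Cx -> 0 < Cy ->
  forall alpha : nat, (2 <= alpha)%N ->
  forall S S' : seq (X * 'rV[R]_dy), neighbors S S' ->
  (renyi_div (@int_out R dx dy T) alpha%:R
     (dpfmix_pdf f1 n m sx sy Cx Cy S)
     (dpfmix_pdf f1 n m sx sy Cx Cy S')
   <= (eps_rdp n m sx sy T alpha)%:E)%E.
Proof. by move=> *; exact: dpfmix_renyi_le. Qed.
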